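(* Let $\mathcal{C}$ and $\mathcal{D}$ be braided monoidal categories and let $F:\mathcal{C}\to\mathcal{D}$ be a strong braided monoidal functor. Then $F$ strongly preserves central idempotents.
   Context: Associators are $\alpha_{ABC}:(A\otimes B)\otimes C\to A\otimes(B\otimes C)$, unitors $\lambda_A:I\otimes A\to A$, $\rho_A:A\otimes I\to A$. For a lax monoidal functor $F$, the structure maps are $\eta^F:I\to F(I)$ and $\mu^F_{AB}:F(A)\otimes F(B)\to F(A\otimes B)$. An object's name also denotes its identity morphism. A half-braiding on an object $U$ of a monoidal category is a natural isomorphism $\sigma_A:U\otimes A\to A\otimes U$ with $\sigma_{A\otimes B}=\alpha^{-1}_{ABU}\circ(A\otimes\sigma_B)\circ\alpha_{AUB}\circ(\sigma_A\otimes B)\circ\alpha^{-1}_{UAB}$. The center $\mathcal{Z}(\mathcal{C})$ has objects $(U,\sigma)$ and morphisms $(U,\sigma)\to(V,\tau)$ those $f:U\to V$ with $\tau_A\circ(f\otimes A)=(A\otimes f)\circ\sigma_A$ for all $A$. A central idempotent is a morphism $u:(U,\sigma)\to(I,\rho^{-1}\circ\lambda)$ in $\mathcal{Z}(\mathcal{C})$ such that $\lambda_U\circ(u\otimes U)=\rho_U\circ(U\otimes u)$ and this morphism $U\otimes U\to U$ is invertible. Two central idempotents are identified if isomorphic in $\mathcal{Z}(\mathcal{C})/I$; $\mathrm{ZI}(\mathcal{C})$ is the collection of central idempotents so identified, and one writes $U\in\mathrm{ZI}(\mathcal{C})$ for the domain $U$ (with half-braiding $\sigma_U$) of a central idempotent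 $u$. If $U,V\in\mathrm{ZI}(\mathcal{C})$ then $U\otimes V\in\mathrm{ZI}(\mathcal{C})$ via $\lambda_I\circ(u\otimes v)$, and $I\in \mathrm{ZI}(\mathcal{C})$ via $\mathrm{id}_I$. A lax monoidal functor $F$ preserves a half-braiding $\sigma$ on $U$ if there is a half-braiding $\tau$ on $F(U)$ with $F(\sigma_A)\circ\mu^F_{UA}=\mu^F_{AU}\circ\tau_{F(A)}$ for all $A\in\mathrm{Ob}(\mathcal{C})$. $F$ weakly preserves central idempotents if it preserves half-braidings of central idempotents and $\eta^F$ and $\mu^F_{AU}$ are invertible for all $A\in\mathrm{Ob}(\mathcal{C})$, $U\in\mathrm{ZI}(\mathcal{C})$. In that case, for a central idempotent $u:U\to I$, $F(\sigma_U)$ denotes the induced half-braiding on $F(U)$, i.e. the (unique) one for which $(\eta^F)^{-1}\circ F(u)$ is a central idempotent in $\mathcal{D}$. $F$ strongly preserves central idempotents if it weakly preserves them and, for all $A\in\mathrm{Ob}(\mathcal{D})$ and $U,V\in\mathrm{ZI}(\mathcal{C})$: (1) $F(\sigma_I)_A=(A\otimes\eta^F)\circ\rho_A^{-1}\circ\lambda_A\circ((\eta^F)^{-1}\otimes A)$; (2) $F(\sigma_{U\otimes V})_A=(A\otimes\mu^F_{UV})\circ\alpha_{A\,F(U)\,F(V)}\circ(F(\sigma_U)_A\otimes F(V))\circ\alpha^{-1}_{F(U)\,A\,F(V)}\circ(F(U)\otimes F(\sigma_V)_A)\circ\alpha_{F(U)\,F(V)\,A}\circ((\mu^F_{UV})^{-1}\otimes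 A)$. *)

(* Defs.v *)
From Stdlib Require Import IndefiniteDescription.

Set Implicit Arguments.
Unset Strict Implicit.
Unset Printing Implicit Defensive.

Declare Scope cat_scope.
Delimit Scope cat_scope with cat.
Open Scope cat_scope.

(** * Categories *)

Record category := Category {
  obj :> Type;
  hom : obj -> obj -> Type;
  idm : forall A, hom A A;
  comp : forall A B C, hom B C -> hom A B -> hom A C;
  comp_idl : forall A B (f : hom A B), comp (idm B) f = f;
  comp_idr : forall A B (f : hom A B), comp f (idm A) = f;
  comp_assoc : forall A B C D (h : hom C D) (g : hom B C) (f : hom A B),
    comp h (comp g f) = comp (comp h g) f }.

Arguments hom {c} A B.
Arguments idm {c} A.
Arguments comp {c A B C} g f.

Notation "A ~> B" := (hom A B) (at level 70, no associativity) : cat_scope.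
Notation "g ∘ f" := (comp g f) (at level 40, left associativity) : cat_scope.

Record iso (C : category) (A B : C) := Iso {
  fwd :> A ~> B;
  bwd : B ~> A;
  iso_bf : bwd ∘ fwd = idm A;
  iso_fb : fwd ∘ bwd = idm B }.

Notation "i ^-1" := (bwd i) (at level 1, left associativity, format "i ^-1")
  : cat_scope.

Definition inverse_of (C : category) (A B : C) (f : A ~> B) (g : B ~> A) : Prop :=
  g ∘ f = idm A /\ f ∘ g = idm B.

Definition is_iso (C : category) (A B : C) (f : A ~> B) : Prop :=
  exists g : B ~> A, inverse_of f g.

Definition inv (C : category) (A B : C) (f : A ~> B) (fi : is_iso f) : B ~> A :=
  proj1_sig (constructive_indefinite_description _ fi).

Lemma invP (C : category) (A B : C) (f : A ~> B) (fi : is_iso f) :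
  inverse_of f (inv fi).
Proof. exact (proj2_sig (constructive_indefinite_description _ fi)). Qed.

(** * Monoidal categories *)

Record monoidal_category := MonoidalCategory {
  mcat :> category;
  unit : mcat;
  tobj : mcat -> mcat -> mcat;
  tmor : forall A B A' B' : mcat,
    A ~> A' -> B ~> B' -> tobj A B ~> tobj A' B';
  tmor_id : forall A B : mcat, tmor (idm A) (idm B) = idm (tobj A B);
  tmor_comp : forall (A B A' B' A'' B'' : mcat)
    (f' : A' ~> A'') (f : A ~> A') (g' : B' ~> B'') (g : B ~> B'),
    tmor (f' ∘ f) (g' ∘ g) = tmor f' g' ∘ tmor f g;
  alpha : forall A B C : mcat, iso (tobj (tobj A B) C) (tobj A (tobj B C));
  lam : forall A : mcat, iso (tobj unit A) A;
  rho : forall A : mcat, iso (tobj A unit) A;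
  alpha_nat : forall (A B C A' B' C' : mcat)
    (f : A ~> A') (g : B ~> B') (h : C ~> C'),
    alpha A' B' C' ∘ tmor (tmor f g) h = tmor f (tmor g h) ∘ alpha A B C;
  lam_nat : forall (A A' : mcat) (f : A ~> A'),
    lam A' ∘ tmor (idm unit) f = f ∘ lam A;
  rho_nat : forall (A A' : mcat) (f : A ~> A'),
    rho A' ∘ tmor f (idm unit) = f ∘ rho A;
  triangle : forall A B : mcat,
    tmor (idm A) (lam B) ∘ alpha A unit B = tmor (rho A) (idm B);
  pentagon : forall A B C D : mcat,
    alpha A B (tobj C D) ∘ alpha (tobj A B) C D
    = tmor (idm A) (alpha B C D) ∘ alpha A (tobj B C) D
        ∘ tmor (alpha A B C) (idm D) }.

Arguments unit {m}.
Arguments tobj {m} A B.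
Arguments tmor {m A B A' B'} f g.
Arguments alpha {m} A B C.
Arguments lam {m} A.
Arguments rho {m} A.

Notation "A ⊗ B" := (tobj A B) (at level 35, right associativity) : cat_scope.
Notation "f ⊠ g" := (tmor f g) (at level 35, no associativity) : cat_scope.
Notation "A ◁ f" := (tmor (idm A) f) (at level 35, no associativity) : cat_scope.
Notation "f ▷ A" := (tmor f (idm A)) (at level 35, no associativity) : cat_scope.

(** * Coherence facts, used to see that the unit lies in the centre *)

Section Coherence.
Variable C : monoidal_category.
Implicit Types A B : C.

Lemma iso_cancel_r (X Y Z : C) (i : iso X Y) (f g : Y ~> Z) :
  f ∘ i = g ∘ i -> f = g.
Proof.
intros H. rewrite <- (comp_idr f), <- (comp_idr g), <- (iso_fb i).
now rewrite !comp_assoc, H.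
Qed.

Lemma iso_cancel_l (X Y Z : C) (i : iso Y Z) (f g : X ~> Y) :
  i ∘ f = i ∘ g -> f = g.
Proof.
intros H. rewrite <- (comp_idl f), <- (comp_idl g), <- (iso_bf i).
now rewrite <- !comp_assoc, H.
Qed.

Lemma whiskerl_comp A (X Y Z : C) (g : Y ~> Z) (f : X ~> Y) :
  A ◁ (g ∘ f) = A ◁ g ∘ A ◁ f.
Proof. now rewrite <- tmor_comp, comp_idl. Qed.

Lemma whiskerr_comp A (X Y Z : C) (g : Y ~> Z) (f : X ~> Y) :
  (g ∘ f) ▷ A = g ▷ A ∘ f ▷ A.
Proof. now rewrite <- tmor_comp, comp_idl. Qed.

Definition iso_whiskerr (X Y : C) (i : iso X Y) A : iso (X ⊗ A) (Y ⊗ A).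
Proof.
exists (i ▷ A) (i^-1 ▷ A).
- now rewrite <- whiskerr_comp, iso_bf, tmor_id.
- now rewrite <- whiskerr_comp, iso_fb, tmor_id.
Defined.

Lemma unit_whiskerl_inj (X Y : C) (f g : X ~> Y) :
  unit ◁ f = unit ◁ g -> f = g.
Proof.
intros H. apply (iso_cancel_r (i := lam X)). now rewrite <- !lam_nat, H.
Qed.

Lemma unit_whiskerr_inj (X Y : C) (f g : X ~> Y) :
  f ▷ unit = g ▷ unit -> f = g.
Proof.
intros H. apply (iso_cancel_r (i := rho X)). now rewrite <- !rho_nat, H.
Qed.

Lemma lam_tensor A B : lam (A ⊗ B) ∘ alpha unit A B = lam A ▷ B.
Proof.
apply unit_whiskerl_inj.
apply (iso_cancel_r (i := alpha unit (unit ⊗ A) B)).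
apply (iso_cancel_r (i := iso_whiskerr (alpha unit unit A) B)).
simpl. rewrite whiskerl_comp, <- !comp_assoc, (comp_assoc (unit ◁ alpha _ _ _)).
rewrite <- pentagon, comp_assoc, triangle.
rewrite (comp_assoc (unit ◁ (lam A ▷ B))), <- alpha_nat, <- comp_assoc.
rewrite <- whiskerr_comp, triangle, alpha_nat, tmor_id.
reflexivity.
Qed.

Lemma rho_tensor A B : (A ◁ rho B) ∘ alpha A B unit = rho (A ⊗ B).
Proof.
apply unit_whiskerr_inj.
apply (iso_cancel_l (i := alpha A B unit)).
rewrite <- (triangle (A ⊗ B) unit), <- tmor_id, comp_assoc, alpha_nat.
rewrite <- (comp_assoc (A ◁ _)), pentagon, !comp_assoc.
rewrite <- whiskerl_comp, triangle, <- alpha_nat, <- comp_assoc.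
now rewrite <- whiskerr_comp.
Qed.

End Coherence.

(** * Braided monoidal categories *)

Record braided_category := BraidedCategory {
  bmon :> monoidal_category;
  braid : forall A B : bmon, iso (A ⊗ B) (B ⊗ A);
  braid_nat : forall (A B A' B' : bmon) (f : A ~> A') (g : B ~> B'),
    braid A' B' ∘ f ⊠ g = g ⊠ f ∘ braid A B;
  hexagon_l : forall A B C : bmon,
    alpha B C A ∘ braid A (B ⊗ C) ∘ alpha A B C
    = B ◁ braid A C ∘ alpha B A C ∘ braid A B ▷ C;
  hexagon_r : forall A B C : bmon,
    (alpha C A B)^-1 ∘ braid (A ⊗ B) C ∘ (alpha A B C)^-1
    = braid A C ▷ B ∘ (alpha A C B)^-1 ∘ A ◁ braid B C }.

Arguments braid {b} A B.

(** * Half-braidings and central idempotents *)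

Record half_braiding (C : monoidal_category) (U : C) := HalfBraiding {
  hb :> forall A : C, U ⊗ A ~> A ⊗ U;
  hb_iso : forall A : C, is_iso (hb A);
  hb_nat : forall (A B : C) (f : A ~> B), hb B ∘ U ◁ f = f ▷ U ∘ hb A;
  hb_tensor : forall A B : C,
    hb (A ⊗ B) = (alpha A B U)^-1 ∘ A ◁ hb B ∘ alpha A U B
                   ∘ hb A ▷ B ∘ (alpha U A B)^-1 }.

Definition unit_half_braiding (C : monoidal_category) : half_braiding (@unit C).
Proof.
refine (@HalfBraiding C unit (fun A => (rho A)^-1 ∘ lam A) _ _ _).
- intros A. exists ((lam A)^-1 ∘ rho A). split.
  + rewrite comp_assoc, <- (comp_assoc _ (rho A)).
    now rewrite iso_fb, comp_idr, iso_bf.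
  + rewrite comp_assoc, <- (comp_assoc _ (lam A)).
    now rewrite iso_fb, comp_idr, iso_bf.
- intros A B f. apply (iso_cancel_l (i := rho B)).
  rewrite !comp_assoc, iso_fb, comp_idl, lam_nat, rho_nat.
  now rewrite <- (comp_assoc f), iso_fb, comp_idr.
- intros A B.
  assert (middle : A ◁ lam B ∘ alpha A unit B ∘ (rho A)^-1 ▷ B = idm _).
  { now rewrite triangle, <- whiskerr_comp, iso_fb, tmor_id. }
  assert (left : lam A ▷ B ∘ (alpha unit A B)^-1 = lam (A ⊗ B)).
  { now rewrite <- lam_tensor, <- comp_assoc, iso_fb, comp_idr. }
  assert (right : (alpha A B unit)^-1 ∘ A ◁ (rho B)^-1 = (rho (A ⊗ B))^-1).
  { apply (iso_cancel_l (i := rho (A ⊗ B))).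
    rewrite iso_fb, <- rho_tensor, comp_assoc, <- (comp_assoc _ (alpha A B unit)).
    now rewrite iso_fb, comp_idr, <- whiskerl_comp, iso_fb, tmor_id. }
  rewrite <- left, <- right, whiskerl_comp, whiskerr_comp, !comp_assoc.
  do 2 f_equal.
  rewrite <- !comp_assoc, (comp_assoc (A ◁ lam B)), middle, comp_idr.
  reflexivity.
Defined.

(* [f] is a morphism [(U, σ) -> (V, τ)] in the centre of [C]. *)
Definition center_morphism (C : monoidal_category) (U V : C)
    (σ : half_braiding U) (τ : half_braiding V) (f : U ~> V) : Prop :=
  forall A : C, τ A ∘ f ▷ A = A ◁ f ∘ σ A.

Record is_central_idempotent (C : monoidal_category) (U : C)
    (σ : half_braiding U) (u : U ~> unit) : Prop := {
  ci_center : center_morphism σ (unit_half_braiding C) u;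
  ci_eq : lam U ∘ u ▷ U = rho U ∘ U ◁ u;
  ci_iso : is_iso (lam U ∘ u ▷ U) }.

(* Representatives of the elements of ZI(C): isomorphic central idempotents
   are not identified here, and the notions below quantify over all
   representatives. *)
Record central_idempotent (C : monoidal_category) := CentralIdempotent {
  ci_obj :> C;
  ci_hb : half_braiding ci_obj;
  ci_map : ci_obj ~> unit;
  ciP : is_central_idempotent ci_hb ci_map }.

Arguments ci_hb {C} c.
Arguments ci_map {C} c.

(** * Monoidal functors *)

Record functor (C D : category) := Functor {
  fobj :> C -> D;
  fmor : forall A B : C, A ~> B -> fobj A ~> fobj B;
  fmor_id : forall A : C, fmor (idm A) = idm (fobj A);
  fmor_comp : forall (X Y Z : C) (g : Y ~> Z) (f : X ~> Y),
    fmor (g ∘ f) = fmor g ∘ fmor f }.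

Arguments fmor {C D} _ {A B} _.

Record lax_functor (C D : monoidal_category) := LaxFunctor {
  lfun :> functor C D;
  eta : unit ~> lfun unit;
  mu : forall A B : C, lfun A ⊗ lfun B ~> lfun (A ⊗ B);
  mu_nat : forall (A B A' B' : C) (f : A ~> A') (g : B ~> B'),
    mu A' B' ∘ fmor lfun f ⊠ fmor lfun g = fmor lfun (f ⊠ g) ∘ mu A B;
  mu_assoc : forall X Y Z : C,
    fmor lfun (alpha X Y Z) ∘ mu (X ⊗ Y) Z ∘ mu X Y ▷ lfun Z
    = mu X (Y ⊗ Z) ∘ lfun X ◁ mu Y Z ∘ alpha (lfun X) (lfun Y) (lfun Z);
  mu_lam : forall A : C,
    fmor lfun (lam A) ∘ mu unit A ∘ eta ▷ lfun A = lam (lfun A);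
  mu_rho : forall A : C,
    fmor lfun (rho A) ∘ mu A unit ∘ lfun A ◁ eta = rho (lfun A) }.

Arguments eta {C D} l.
Arguments mu {C D} l A B.

Definition is_strong (C D : monoidal_category) (F : lax_functor C D) : Prop :=
  is_iso (eta F) /\ forall A B : C, is_iso (mu F A B).

Definition is_braided (C D : braided_category) (F : lax_functor C D) : Prop :=
  forall A B : C, fmor F (braid A B) ∘ mu F A B = mu F B A ∘ braid (F A) (F B).

(** * Preservation of central idempotents *)

Definition preserves_half_braiding (C D : monoidal_category)
    (F : lax_functor C D) (U : C) (σ : half_braiding U) : Prop :=
  exists τ : half_braiding (F U),
    forall A : C, fmor F (σ A) ∘ mu F U A = mu F A U ∘ τ (F A).

Record weakly_preserves_ci (C D : monoidal_category) (F : lax_functor C D)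
    : Prop := {
  wp_hb : forall U : central_idempotent C, preserves_half_braiding F (ci_hb U);
  wp_eta : is_iso (eta F);
  wp_mu : forall (A : C) (U : central_idempotent C), is_iso (mu F A U) }.

Arguments wp_hb {C D F} w U.
Arguments wp_eta {C D F} w.
Arguments wp_mu {C D F} w A U.

(* [τ] is the induced half-braiding [F(σ_U)] on [F U]: the unique one for which
   [eta^-1 ∘ F u] is a central idempotent.  It depends on the central idempotent
   only through its morphism [u].  Using [exists τ, induced_half_braiding wp u τ
   /\ P τ] to state [P (F(σ_U))] asserts existence and uniqueness along with
   [P]. *)
Definition induced_half_braiding (C D : monoidal_category)
    (F : lax_functor C D) (wp : weakly_preserves_ci F)
    (U : C) (u : U ~> unit) (τ : half_braiding (F U)) : Prop :=
  is_central_idempotent τ (inv (wp_eta wp) ∘ fmor F u) /\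
  forall τ' : half_braiding (F U),
    is_central_idempotent τ' (inv (wp_eta wp) ∘ fmor F u) ->
    forall A : D, τ' A = τ A.

Definition induced_unit_condition (C D : monoidal_category)
    (F : lax_functor C D) (wp : weakly_preserves_ci F) : Prop :=
  exists τ : half_braiding (F unit),
    induced_half_braiding wp (idm unit) τ /\
    forall A : D,
      τ A = A ◁ eta F ∘ (rho A)^-1 ∘ lam A ∘ inv (wp_eta wp) ▷ A.

Definition induced_tensor_condition (C D : monoidal_category)
    (F : lax_functor C D) (wp : weakly_preserves_ci F) : Prop :=
  forall U V : central_idempotent C,
  exists (τU : half_braiding (F U)) (τV : half_braiding (F V))
         (τUV : half_braiding (F (U ⊗ V))),
    induced_half_braiding wp (ci_map U) τU /\
    induced_half_braiding wp (ci_map V) τV /\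
    induced_half_braiding wp (lam unit ∘ ci_map U ⊠ ci_map V) τUV /\
    forall A : D,
      τUV A = A ◁ mu F U V ∘ alpha A (F U) (F V) ∘ τU A ▷ F V
                ∘ (alpha (F U) A (F V))^-1 ∘ F U ◁ τV A
                ∘ alpha (F U) (F V) A ∘ inv (wp_mu wp U V) ▷ A.

Definition strongly_preserves_ci (C D : monoidal_category)
    (F : lax_functor C D) : Prop :=
  exists wp : weakly_preserves_ci F,
    induced_unit_condition wp /\ induced_tensor_condition wp.

(* Main.v *)
(** In a braided category a morphism [u : U -> I] underlies a central
    idempotent as soon as [u ⊗ U] is invertible: any object [Z] with [u ⊗ Z]
    invertible sees [A ⊗ u] as a monomorphism, which gives the equation
    [λ (u ⊗ U) = ρ (U ⊗ u)] and also shows that the braiding is the only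
    half-braiding making [u] central.  Hence every half-braiding involved is a
    braiding, and the conditions on [F] reduce to naturality, the unit law and
    the hexagon for the braiding. *)

Require Import Defs.

Set Implicit Arguments.
Unset Strict Implicit.

(** * Cancellation and transport of invertibility *)

Section Isomorphisms.
Variable C : category.

Lemma is_iso_fwd (X Y : C) (i : iso X Y) : is_iso i.
Proof. exists (i^-1). split; [apply iso_bf | apply iso_fb]. Qed.

Lemma is_iso_comp (X Y Z : C) (g : Y ~> Z) (f : X ~> Y) :
  is_iso g -> is_iso f -> is_iso (g ∘ f).
Proof.
intros [g' [gl gr]] [f' [fl fr]]. exists (f' ∘ g'). split.
- now rewrite comp_assoc, <- (comp_assoc f'), gl, comp_idr.
- now rewrite comp_assoc, <- (comp_assoc g), fr, comp_idr.
Qed.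

Lemma is_iso_inv (X Y : C) (f : X ~> Y) (fi : is_iso f) : is_iso (inv fi).
Proof. exists f. destruct (invP fi). now split. Qed.

Lemma is_iso_mono (X Y Z : C) (h : Y ~> Z) (f g : X ~> Y) :
  is_iso h -> h ∘ f = h ∘ g -> f = g.
Proof.
intros [h' [hl _]] H. rewrite <- (comp_idl f), <- (comp_idl g), <- hl.
now rewrite <- !comp_assoc, H.
Qed.

Lemma is_iso_epi (X Y Z : C) (h : X ~> Y) (f g : Y ~> Z) :
  is_iso h -> f ∘ h = g ∘ h -> f = g.
Proof.
intros [h' [_ hr]] H. rewrite <- (comp_idr f), <- (comp_idr g), <- hr.
now rewrite !comp_assoc, H.
Qed.

Lemma is_iso_cancel_l (X Y Z : C) (g : Y ~> Z) (f : X ~> Y) :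
  is_iso g -> is_iso (g ∘ f) -> is_iso f.
Proof.
intros gi [k [kl kr]]. exists (k ∘ g). split.
- now rewrite <- comp_assoc.
- apply (is_iso_mono gi). now rewrite !comp_assoc, kr, comp_idl, comp_idr.
Qed.

Lemma is_iso_cancel_r (X Y Z : C) (g : Y ~> Z) (f : X ~> Y) :
  is_iso f -> is_iso (g ∘ f) -> is_iso g.
Proof.
intros fi [k [kl kr]]. exists (f ∘ k). split.
- apply (is_iso_epi fi). now rewrite <- !comp_assoc, kl, comp_idl, comp_idr.
- now rewrite comp_assoc.
Qed.

Lemma is_iso_square (X Y X' Y' : C) (i : X ~> X') (j : Y ~> Y')
    (f : X ~> Y) (g : X' ~> Y') :
  is_iso i -> is_iso j -> j ∘ f = g ∘ i -> (is_iso f <-> is_iso g).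
Proof.
intros ii ji H. split; intros K.
- apply (is_iso_cancel_r ii). rewrite <- H. now apply is_iso_comp.
- apply (is_iso_cancel_l ji). rewrite H. now apply is_iso_comp.
Qed.

End Isomorphisms.

Lemma is_iso_fmor (C D : category) (F : functor C D) (X Y : C) (f : X ~> Y) :
  is_iso f -> is_iso (fmor F f).
Proof.
intros [g [gl gr]]. exists (fmor F g).
split; now rewrite <- fmor_comp, ?gl, ?gr, fmor_id.
Qed.

(** * Unitors at the unit, and invertibility under tensoring *)

Section Monoidal.
Variable C : monoidal_category.

Lemma is_iso_tmor (X Y X' Y' : C) (f : X ~> X') (g : Y ~> Y') :
  is_iso f -> is_iso g -> is_iso (f ⊠ g).
Proof.
intros [f' [fl fr]] [g' [gl gr]]. exists (f' ⊠ g').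
split; now rewrite <- tmor_comp, ?fl, ?gl, ?fr, ?gr, tmor_id.
Qed.

Lemma is_iso_idm (X : C) : is_iso (idm X).
Proof. exists (idm X). split; apply comp_idl. Qed.

Lemma tmor_split_l (X Y X' Y' : C) (f : X ~> X') (g : Y ~> Y') :
  f ⊠ g = X' ◁ g ∘ f ▷ Y.
Proof. now rewrite <- tmor_comp, comp_idl, comp_idr. Qed.

Lemma tmor_split_r (X Y X' Y' : C) (f : X ~> X') (g : Y ~> Y') :
  f ⊠ g = f ▷ Y' ∘ X ◁ g.
Proof. now rewrite <- tmor_comp, comp_idl, comp_idr. Qed.

(** Naturality of [lam] at the morphism [lam A] itself, with [lam A] cancelled. *)
Lemma lam_unit_tensor (A : C) : fwd (lam (unit ⊗ A)) = unit ◁ lam A.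
Proof. apply (iso_cancel_l (i := lam A)). now rewrite lam_nat. Qed.

(** Tensored with [unit] on the right, both become [unit ◁ lam unit] after the same associator, by
    [triangle] and [lam_tensor]. *)
Lemma lam_rho_unit : fwd (lam (@unit C)) = fwd (rho unit).
Proof.
apply unit_whiskerr_inj.
now rewrite <- triangle, <- lam_tensor, lam_unit_tensor.
Qed.

Lemma is_iso_whiskerr_iso (U Z Z' : C) (u : U ~> unit) (i : iso Z Z') :
  is_iso (u ▷ Z) -> is_iso (u ▷ Z').
Proof.
apply (is_iso_square (i := U ◁ i) (j := unit ◁ i)).
- apply is_iso_tmor; [apply is_iso_idm | apply is_iso_fwd].
- apply is_iso_tmor; [apply is_iso_idm | apply is_iso_fwd].
- now rewrite <- tmor_split_l, <- tmor_split_r.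
Qed.

Lemma is_iso_tmor_assoc (X Y Z X' Y' Z' : C)
    (f : X ~> X') (g : Y ~> Y') (h : Z ~> Z') :
  is_iso ((f ⊠ g) ⊠ h) <-> is_iso (f ⊠ (g ⊠ h)).
Proof. eapply is_iso_square; [| | apply alpha_nat]; apply is_iso_fwd. Qed.

Lemma is_iso_whiskerr_tensor (U Z A : C) (u : U ~> unit) :
  is_iso (u ▷ Z) -> is_iso (u ▷ (Z ⊗ A)).
Proof.
intros H. rewrite <- tmor_id. apply is_iso_tmor_assoc.
apply is_iso_tmor; [exact H | apply is_iso_idm].
Qed.

End Monoidal.

(** * Half-braidings of central idempotents in a braided category *)

Section Braided.
Variable C : braided_category.

Lemma braid_unit (A : C) : fwd (braid unit A) = (rho A)^-1 ∘ lam A.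
Proof.
apply (iso_cancel_l (i := rho A)). rewrite comp_assoc, iso_fb, comp_idl.
assert (xi : is_iso (rho A ∘ braid unit A))
  by (apply is_iso_comp; apply is_iso_fwd).
apply unit_whiskerl_inj. apply (is_iso_mono xi). symmetry.
assert (tri : rho A ▷ unit ∘ (alpha A unit unit)^-1 = A ◁ lam unit).
{ now rewrite <- triangle, <- comp_assoc, iso_fb, comp_idr. }
assert (lt : lam unit ▷ A ∘ (alpha unit unit A)^-1 = unit ◁ lam A).
{ now rewrite <- lam_tensor, <- comp_assoc, iso_fb, comp_idr, lam_unit_tensor. }
assert (rt : rho (unit ⊗ A) ∘ (alpha unit A unit)^-1 = unit ◁ rho A).
{ now rewrite <- rho_tensor, <- comp_assoc, iso_fb, comp_idr. }
(* Closing both sides of this hexagon with [rho] turns it into [x ∘ unit ◁ lam A = x ∘ unit ◁ x] for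
   [x = rho A ∘ braid unit A]; cancelling the invertible [x] yields [lam A = x]. *)
assert (hex := f_equal (fun f => rho A ∘ (rho A ▷ unit ∘ f))
                 (hexagon_r unit unit A)).
simpl in hex. revert hex.
rewrite !(comp_assoc (rho A ▷ unit)), tri, <- whiskerr_comp.
rewrite <- braid_nat, <- (comp_assoc (braid unit A)), lt.
rewrite !(comp_assoc (rho A)), rho_nat.
rewrite <- (comp_assoc _ (rho (unit ⊗ A))), rt.
now rewrite <- (comp_assoc _ (unit ◁ rho A)), <- whiskerl_comp.
Qed.

Definition braid_half_braiding (U : C) : half_braiding U.
Proof.
refine (@HalfBraiding C U (fun A => fwd (braid U A)) _ _ _).
- intros A. apply is_iso_fwd.
- intros A B f. apply braid_nat.
- intros A B. apply (iso_cancel_r (i := alpha U A B)).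
  apply (iso_cancel_l (i := alpha A B U)).
  rewrite <- !(comp_assoc _ ((alpha U A B)^-1)), iso_bf, comp_idr.
  rewrite !comp_assoc, iso_fb, comp_idl. apply hexagon_l.
Defined.

Lemma is_iso_whisker_swap (U Z : C) (u : U ~> unit) :
  is_iso (u ▷ Z) <-> is_iso (Z ◁ u).
Proof.
eapply is_iso_square; [| | apply braid_nat]; apply is_iso_fwd.
Qed.

(** Tensoring with [U] makes [A ◁ u] invertible, since the braiding turns [(U ⊗ A) ◁ u] into
    [u ▷ (U ⊗ A)]; hence [U ◁ f = U ◁ g]. Interchanging with [u] then moves this equality from [U]
    to [unit], where [u ▷ Z] cancels. *)
Lemma whiskerl_mono (U Z A : C) (u : U ~> unit) (f g : Z ~> A ⊗ U) :
  is_iso (u ▷ U) -> is_iso (u ▷ Z) -> A ◁ u ∘ f = A ◁ u ∘ g -> f = g.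
Proof.
intros ui zi H.
assert (k : is_iso (U ◁ (A ◁ u))).
{ apply is_iso_tmor_assoc. rewrite tmor_id. apply is_iso_whisker_swap.
  now apply is_iso_whiskerr_tensor. }
assert (E : U ◁ f = U ◁ g).
{ apply (is_iso_mono k). now rewrite <- !whiskerl_comp, H. }
apply unit_whiskerl_inj. apply (is_iso_epi zi).
now rewrite <- !tmor_split_l, (tmor_split_r u f), (tmor_split_r u g), E.
Qed.

(** The case [A = unit] of [whiskerl_mono], read through [lam U]. *)
Lemma counit_mono (U Z : C) (u : U ~> unit) (f g : Z ~> U) :
  is_iso (u ▷ U) -> is_iso (u ▷ Z) -> u ∘ f = u ∘ g -> f = g.
Proof.
intros ui zi H.
assert (K : (lam U)^-1 ∘ f = (lam U)^-1 ∘ g).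
{ apply (whiskerl_mono ui zi). apply (iso_cancel_l (i := lam unit)).
  rewrite !comp_assoc, lam_nat, <- !(comp_assoc u), iso_fb.
  now rewrite !comp_idl. }
apply (f_equal (comp (lam U))) in K.
now rewrite !comp_assoc, iso_fb, !comp_idl in K.
Qed.

Lemma central_idempotent_braid (U : C) (u : U ~> unit) :
  is_iso (u ▷ U) -> is_central_idempotent (braid_half_braiding U) u.
Proof.
intros ui. split.
- intros A. simpl. now rewrite <- braid_unit, braid_nat.
(* After composition with [u] the two sides are [lam unit] and [rho unit] applied to [u ⊠ u]. *)
- apply (counit_mono ui); [now apply is_iso_whiskerr_tensor |].
  rewrite !comp_assoc, <- lam_nat, <- rho_nat, <- !comp_assoc.
  now rewrite <- tmor_split_l, <- tmor_split_r, lam_rho_unit.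
- apply is_iso_comp; [apply is_iso_fwd | exact ui].
Qed.

Lemma central_idempotent_is_iso (U : C) (σ : half_braiding U) (u : U ~> unit) :
  is_central_idempotent σ u -> is_iso (u ▷ U).
Proof.
intros H. exact (is_iso_cancel_l (is_iso_fwd (lam U)) (ci_iso H)).
Qed.

(** Centrality of [u] for [σ] and for the braiding gives both the same composite with [A ◁ u], which
    can be cancelled. *)
Lemma central_idempotent_hb (U : C) (σ : half_braiding U) (u : U ~> unit) :
  is_central_idempotent σ u -> forall A : C, σ A = braid U A.
Proof.
intros H A. assert (ui := central_idempotent_is_iso H).
apply (whiskerl_mono ui); [now apply is_iso_whiskerr_tensor |].
transitivity (unit_half_braiding C A ∘ u ▷ A).
- symmetry. apply (ci_center H).
- apply (ci_center (central_idempotent_braid ui)).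
Qed.

Lemma tensor_whisker_is_iso (U V : C) (u : U ~> unit) (v : V ~> unit) :
  is_iso (u ▷ U) -> is_iso (v ▷ V) ->
  is_iso ((lam unit ∘ u ⊠ v) ▷ (U ⊗ V)).
Proof.
intros ui vi.
(* The map factors as [v ∘ lam V ∘ u ▷ V]. For the outer two factors, the braiding reorders the
   objects tensored on the right so that [V], respectively [U], comes first. *)
rewrite (tmor_split_l u v), comp_assoc, lam_nat, !whiskerr_comp.
apply is_iso_comp; [apply is_iso_comp |].
- apply (is_iso_whiskerr_iso (braid V U)). now apply is_iso_whiskerr_tensor.
- apply is_iso_tmor; [apply is_iso_fwd | apply is_iso_idm].
- apply is_iso_tmor_assoc. rewrite tmor_id.
  apply (is_iso_whiskerr_iso (braid (U ⊗ V) V)).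
  now do 2 apply is_iso_whiskerr_tensor.
Qed.

Lemma braid_tensor (U V A : C) :
  fwd (braid (U ⊗ V) A)
  = alpha A U V ∘ braid U A ▷ V ∘ (alpha U A V)^-1 ∘ U ◁ braid V A
      ∘ alpha U V A.
Proof.
rewrite <- (comp_assoc (alpha A U V)), <- (comp_assoc (alpha A U V)).
rewrite <- hexagon_r, !comp_assoc, iso_fb, comp_idl.
now rewrite <- comp_assoc, iso_bf, comp_idr.
Qed.

(** Used with [eta] and [mu] as [f]: it produces the conjugated shape of the unit and tensor
    conditions. *)
Lemma braid_conj (X Y A : C) (f : X ~> Y) (fi : is_iso f) :
  fwd (braid Y A) = A ◁ f ∘ braid X A ∘ inv fi ▷ A.
Proof.
rewrite <- braid_nat, <- comp_assoc, <- whiskerr_comp.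
now rewrite (proj2 (invP fi)), tmor_id, comp_idr.
Qed.

End Braided.

(** * Transport along strong and braided functors *)

Section Functor.
Variables C D : braided_category.
Variable F : lax_functor C D.

Lemma fmor_whisker_is_iso (F_strong : is_strong F) (U : C) (u : U ~> unit)
    (ei : is_iso (eta F)) :
  is_iso (u ▷ U) -> is_iso ((inv ei ∘ fmor F u) ▷ F U).
Proof.
intros ui. rewrite whiskerr_comp. apply is_iso_comp.
- apply is_iso_tmor; [apply is_iso_inv | apply is_iso_idm].
(* With the identity written as the image of [idm U], naturality of [mu] compares this map with the
   image of [u ▷ U]. *)
- rewrite <- fmor_id.
  apply (proj2 (is_iso_square (proj2 F_strong _ _) (proj2 F_strong _ _)
                  (mu_nat F u (idm U)))).
  now apply is_iso_fmor.
Qed.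

Lemma induced_half_braiding_braid (F_strong : is_strong F)
    (wp : weakly_preserves_ci F) (U : C) (u : U ~> unit) :
  is_iso (u ▷ U) -> induced_half_braiding wp u (braid_half_braiding (F U)).
Proof.
intros ui. split.
- apply central_idempotent_braid. now apply fmor_whisker_is_iso.
- intros τ' H A. exact (central_idempotent_hb H A).
Qed.

Lemma strong_braided_weakly_preserves_ci :
  is_strong F -> is_braided F -> weakly_preserves_ci F.
Proof.
intros [ei mi] Fb. split.
- intros U. exists (braid_half_braiding (F U)). intros A.
  (* Once the given half-braiding is replaced by the braiding, preservation is an instance of
     [is_braided]. *)
  rewrite (central_idempotent_hb (ciP U) A). apply Fb.
- exact ei.
- intros A U. apply mi.
Qed.

End Functor.

Theorem corollary4p10 (C D : braided_category) (F : lax_functor C D)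
  (F_strong : is_strong F) (F_braided : is_braided F) :
  strongly_preserves_ci F.
Proof.
exists (strong_braided_weakly_preserves_ci F_strong F_braided).
set (wp := strong_braided_weakly_preserves_ci _ _). split.
- exists (braid_half_braiding (F unit)). split.
  + apply (induced_half_braiding_braid F_strong).
    rewrite tmor_id. apply is_iso_idm.
  + intros A. simpl. rewrite (braid_conj A (wp_eta wp)), braid_unit.
    now rewrite !comp_assoc.
- intros U V.
  assert (ui := central_idempotent_is_iso (ciP U)).
  assert (vi := central_idempotent_is_iso (ciP V)).
  exists (braid_half_braiding (F U)), (braid_half_braiding (F V)),
    (braid_half_braiding (F (U ⊗ V))).
  split; [| split; [| split]].
  + now apply (induced_half_braiding_braid F_strong).
  + now apply (induced_half_braiding_braid F_strong).
  + apply (induced_half_braiding_braid F_strong).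
    now apply tensor_whisker_is_iso.
  + intros A. simpl. rewrite (braid_conj A (wp_mu wp U V)), braid_tensor.
    now rewrite !comp_assoc.
Qed.
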